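(* For integers $m\ge 1$ let $$T(m)=\sum_{r=2}^{m+1}\binom{2r}{r}\binom{m+1}{r}\frac{r-1}{2^{r}\binom{4m}{r}}.$$ Then $$\lim_{m\to\infty}T(m)=\frac{2-\sqrt2}{2}.$$ *)

(* Defs.v *)
From HB Require Import structures.
From mathcomp Require Import all_boot all_order all_algebra.
From mathcomp Require Import all_classical all_reals all_analysis.

Set Implicit Arguments.
Unset Strict Implicit.
Unset Printing Implicit Defensive.

Import Order.TTheory GRing.Theory Num.Theory.
Local Open Scope ring_scope.

(* T(m) is meant for m >= 1, where every denominator is nonzero because
   r <= m + 1 <= 4 m; at the extra index m = 0 the sum is empty. *)
Definition T (R : realType) (m : nat) : R :=
  \sum_(2 <= r < m.+2)
    'C(2 * r, r)%:R * 'C(m + 1, r)%:R *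
    ((r%:R - 1) / (2 ^+ r * 'C(4 * m, r)%:R)).

(* Main.v *)
Require Import Defs.
From HB Require Import structures.
From mathcomp Require Import all_boot all_order all_algebra.
From mathcomp Require Import all_classical all_reals all_analysis.
From mathcomp Require Import ring lra zify.

Set Implicit Arguments.
Unset Strict Implicit.
Unset Printing Implicit Defensive.

Import Order.TTheory GRing.Theory Num.Theory.
Import numFieldNormedType.Exports.
Local Open Scope classical_set_scope.
Local Open Scope ring_scope.

(* Since [C(m+1, r) / C(4m, r)] tends to [4^-r] and is at most [(3/8)^r] for
   [m >= 2], Tannery's theorem gives the limit [\sum_(r >= 2) (r - 1) a_r] with
   [a_r = C(2r, r) / 8^r].  The recurrence [(r+1) a_(r+1) = (2r+1)/4 a_r] yields
   both [\sum_(r < n) (r - 1) a_r = - (\sum_(r < n) a_r) / 2 - 2 n a_n] and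
   [\sum_(k <= n) a_k a_(n-k) = 2^-n], and the latter squeezes the square of
   [\sum_(r < n) a_r] between two partial sums of the geometric series with
   sum [2]. *)

(** * Dominated convergence for sums of growing length *)

Lemma tannery (R : realType) (F : nat -> R^nat) (g h : R^nat) (N : nat -> nat)
    (L : R) :
  (forall r, F m r @[m --> \oo] --> g r) ->
  (\forall m \near \oo, forall r, `|F m r| <= h r) ->
  cvgn (series h) -> N m @[m --> \oo] --> \oo -> series g @ \oo --> L ->
  series (F m) (N m) @[m --> \oo] --> L.
Proof.
move=> Fg Fh /cvg_ex[H hH] Noo gL; apply/cvgrPdist_le => e e0.
(* The error has four quarters: cut at a fixed [K], the tail of [F m] from [K] to [N m] costs two,
   as [series h] is within [e / 4] of [H] at both ends. The head of [F m] against that of [g], and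
   the tail of [g], cost one each. *)
have e4 : 0 < e / 4 by rewrite divr_gt0.
have /cvgrPdist_le/(_ _ e4)[K0 _ hK] := hH.
have /cvgrPdist_le/(_ _ e4)[K1 _ gK] := gL.
pose K := maxn K0 K1.
have K0K : (K0 <= K)%N by exact: leq_maxl.
have FK : series (F m) K @[m --> \oo] --> series g K.
  elim: K {K0K} => [|k IH].
    by under eq_fun do rewrite /series /= big_geq//; rewrite /series /= big_geq//;
       exact: cvg_cst.
  by under eq_fun do rewrite seriesSr; rewrite seriesSr; exact: cvgD.
move/cvgrPdist_le/(_ _ e4) : FK => FK.
near=> m.
have KN : (K <= N m)%N by near: m; exact: (Noo _ (nbhs_infty_ge K)).
have Fhm : forall r, `|F m r| <= h r by near: m.
have tail : `|series (F m) (N m) - series (F m) K| <=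
    series h (N m) - series h K.
  rewrite !sub_series_geq//; apply: le_trans (ler_norm_sum _ _ _) _.
  by apply: ler_sum => r _; exact: Fhm.
have hN : `|H - series h (N m)| <= e / 4 by apply: hK; exact: leq_trans KN.
have {}hK : `|H - series h K| <= e / 4 by exact: hK.
have {}gK : `|L - series g K| <= e / 4 by apply: gK; exact: leq_maxr.
have FKm : `|series g K - series (F m) K| <= e / 4 by near: m.
move: tail hN hK gK FKm; rewrite !ler_norml; lra.
Unshelve. all: by end_near. Qed.

(** * Scaled central binomial coefficients and their sums *)

Section CentralBinomial.
Variable R : realType.

Definition a (r : nat) : R := 'C(2 * r, r)%:R / 8 ^+ r.

Lemma central_binomialS r :
  ((r.+1) * 'C(2 * r.+1, r.+1) = (4 * r + 2) * 'C(2 * r, r))%N.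
Proof.
(* [e1] and [e2] express both Pascal summands in [e5] through ['C(2 * r, r)]; each contributes
   [(2 * r + 1) * 'C(2 * r, r)] once multiplied by [r.+1]. *)
have e1 := mul_bin_diag (2 * r).+1 r.
have e2 := mul_bin_down (2 * r).+1 r.
have e3 := mul_bin_diag (2 * r) r.
have e4 := mul_bin_left (2 * r) r.
rewrite (_ : 2 * r.+1 = (2 * r).+2)%N; last lia.
have e5 := binS (2 * r).+1 r.
have e6 := binS (2 * r) r.
move: e1 e2 e3 e4 e5 e6; rewrite /= => *.
nia.
Qed.

Lemma aS r : r.+1%:R * a r.+1 = (2 * r%:R + 1) / 4 * a r.
Proof.
have := congr1 (fun n => n%:R : R) (central_binomialS r).
rewrite !natrM natrD natrM => e.
rewrite /a exprS; rewrite [LHS]mulrA e.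
have : (8 : R) ^+ r != 0 by rewrite expf_neq0.
by move=> ?; field.
Qed.

Lemma a_ge0 r : 0 <= a r.
Proof. by rewrite divr_ge0// exprn_ge0. Qed.

Lemma a_le r : a r <= (1 / 2) ^+ r.
Proof.
elim: r => [|r IH]; first by rewrite /a bin0 !expr0 divr1.
rewrite exprS -(ler_pM2l (_ : 0 < r.+1%:R :> R))// aS.
apply: le_trans (ler_wpM2l _ IH) _.
  by rewrite divr_ge0// addr_ge0// mulr_ge0.
rewrite mulrA ler_wpM2r ?exprn_ge0//.
by rewrite -[r.+1%:R]natr1; lra.
Qed.

(** The generating function of [a] is (1 - x/2)^(-1/2), whose square is the geometric series 1/(1 -
    x/2). *)
Lemma a_conv n : \sum_(k < n.+1) a k * a (n - k) = (1 / 2) ^+ n.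
Proof.
(* The symmetry [k <-> n - k] averages the weight [k] to [n / 2]. *)
have half p : \sum_(k < p.+1) k%:R * (a k * a (p - k)) =
    p%:R / 2 * \sum_(k < p.+1) a k * a (p - k).
  set S := LHS.
  have : S = \sum_(k < p.+1) (p - k)%:R * (a k * a (p - k)).
    rewrite /S (reindex_inj rev_ord_inj) /=; apply: eq_bigr => k _.
    rewrite subSS subKn; last by rewrite -ltnS.
    by rewrite [a (p - k) * _]mulrC.
  move=> S2; suff : S + S = p%:R * \sum_(k < p.+1) a k * a (p - k) by lra.
  rewrite {2}S2 -big_split mulr_sumr; apply: eq_bigr => k _ /=.
  by rewrite -mulrDl -natrD subnKC// -ltnS.
elim: n => [|n IH]; first by rewrite big_ord1 /a bin0 !expr0 divr1 mulr1.
have n0 : n.+1%:R != 0 :> R by [].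
(* Read backwards, [half] restores a weight [k], which kills the term [k = 0] and lets [aS] lower
   the index of the others; [half] at [n] then removes the new weight. *)
apply: (@mulfI _ (n.+1%:R / 2)); first by rewrite mulf_neq0.
rewrite -half big_ord_recl mul0r add0r.
rewrite (eq_bigr (fun k : 'I_n.+1 =>
    (2 * k%:R + 1) / 4 * (a k * a (n - k)))); last first.
  by move=> k _; rewrite lift0 subSS mulrA aS -!mulrA.
have -> : \sum_(k < n.+1) (2 * k%:R + 1) / 4 * (a k * a (n - k)) =
    1 / 2 * (\sum_(k < n.+1) k%:R * (a k * a (n - k))) +
    1 / 4 * \sum_(k < n.+1) a k * a (n - k).
  rewrite !mulr_sumr -big_split /=; apply: eq_bigr => k _; by field.
rewrite half IH exprS -[n.+1%:R]natr1; by field.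
Qed.

Lemma sum_half n : \sum_(k < n) (1 / 2 : R) ^+ k = 2 - 2 * (1 / 2) ^+ n.
Proof.
elim: n => [|n IH]; first by rewrite big_ord0 expr0; lra.
by rewrite big_ord_recr /= IH exprS; lra.
Qed.

(** Truncate the generating function to a polynomial [p]: the square is the sum of the coefficients
    of [p * p]. Below degree [n] they are the full convolutions [(1 / 2) ^+ i]; from [n] on they lie
    between 0 and [(1 / 2) ^+ i]. *)
Lemma series_a_sqr n :
  2 - 2 * (1 / 2) ^+ n <= (series a n) ^+ 2 <= 2.
Proof.
pose p := \poly_(i < n) a i.
have a_coef i : 0 <= p`_i <= a i.
  by rewrite coef_poly; case: ifP => _; rewrite ?lexx ?a_ge0.
have pE : series a n = p.[1].
  rewrite seriesEord /p horner_poly; apply: eq_bigr => i _.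
  by rewrite expr1n mulr1.
have ppE : (series a n) ^+ 2 = \sum_(i < n + n) (p * p)`_i.
  rewrite pE expr2 -hornerM (@horner_coef_wide _ (n + n)).
    by apply: eq_bigr => i _; rewrite expr1n mulr1.
  apply: leq_trans (size_polyMleq _ _) _.
  have sp : (size p <= n)%N by exact: size_poly.
  by rewrite -subn1; apply: leq_trans (leq_subr _ _) (leq_add sp sp).
have pp_ge0 i : 0 <= (p * p)`_i.
  rewrite coefM sumr_ge0// => j _.
  by have /andP[? _] := a_coef j; have /andP[? _] := a_coef (i - j)%N;
     rewrite mulr_ge0.
have pp_le i : (p * p)`_i <= (1 / 2) ^+ i.
  rewrite coefM -a_conv; apply: ler_sum => j _.
  by have /andP[? ?] := a_coef j; have /andP[? ?] := a_coef (i - j)%N;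
     rewrite ler_pM.
rewrite ppE; apply/andP; split; last first.
  apply: (@le_trans _ _ (\sum_(i < n + n) (1 / 2) ^+ i)).
    by apply: ler_sum => i _; exact: pp_le.
  by rewrite sum_half lerBlDr lerDl mulr_ge0// exprn_ge0.
rewrite big_split_ord /= -sum_half -[leLHS]addr0 lerD ?sumr_ge0//.
apply: ler_sum => i _; rewrite coefM -a_conv; apply: ler_sum => j _.
by rewrite !coef_poly !ifT//; have := ltn_ord i; have := ltn_ord j; lia.
Qed.

Lemma cvg_series_a : series a @ \oo --> Num.sqrt 2.
Proof.
have -> : series a = (fun n => Num.sqrt ((series a n) ^+ 2)).
  apply/funext => n; rewrite sqrtr_sqr ger0_norm//.
  by rewrite /series /= sumr_ge0// => i _; exact: a_ge0.
apply: continuous_cvg; first exact: sqrt_continuous.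
apply: (@squeeze_cvgr _ _ _ _ (fun n => 2 - 2 * (1 / 2) ^+ n) (fun=> 2)).
- by near=> n; exact: series_a_sqr.
- rewrite -[X in _ --> X]subr0 -[X in _ - X](mulr0 2).
  apply: cvgB; first exact: cvg_cst.
  apply: cvgM; first exact: cvg_cst.
  by apply: cvg_expr; rewrite ger0_norm; lra.
- exact: cvg_cst.
Unshelve. all: by end_near. Qed.

(** Serves twice: as the dominating series for [tannery], and through its vanishing terms, which
    force [n%:R * a n] to 0. *)
Lemma is_cvg_series_natM_geometric :
  cvgn (series (fun r => r.+1%:R * (3 / 4 : R) ^+ r)).
Proof.
have E n : series (fun r => r.+1%:R * (3 / 4 : R) ^+ r) n =
    16 - (4 * n%:R + 16) * (3 / 4) ^+ n.
  elim: n => [|n IH]; first by rewrite /series /= big_geq// expr0; lra.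
  by rewrite seriesSr IH exprS -[n.+1%:R]natr1; field.
apply: nondecreasing_is_cvgn.
  apply/nondecreasing_seqP => n; rewrite seriesSr lerDl.
  by rewrite mulr_ge0// exprn_ge0//; lra.
by exists 16 => _ [n _ <-]; rewrite E lerBlDr lerDl mulr_ge0.
Qed.

Lemma cvg_series_pred_a :
  series (fun r => (r%:R - 1) * a r) @ \oo --> - Num.sqrt 2 / 2.
Proof.
(* By [aS], each term is [- a r / 2 - 2 * (r.+1%:R * a r.+1 - r%:R * a r)], whose second part
   telescopes. *)
have E n : series (fun r => (r%:R - 1) * a r) n =
    - series a n / 2 - 2 * (n%:R * a n).
  elim: n => [|n IH]; first by rewrite /series /= !big_geq// mul0r; lra.
  by rewrite !seriesSr IH aS; field.
rewrite (_ : series _ = fun n => - series a n / 2 - 2 * (n%:R * a n)); last first.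
  exact/funext.
rewrite -[X in _ --> X]subr0 -[X in _ - X](mulr0 2).
apply: cvgB.
  by apply: cvgMr_tmp; apply: cvgN; exact: cvg_series_a.
apply: cvgMl_tmp.
apply: (@squeeze_cvgr _ _ _ _ (fun=> 0) (fun r => r.+1%:R * (3 / 4 : R) ^+ r)).
- near=> n; rewrite mulr_ge0 ?a_ge0//= ler_pM ?a_ge0 ?ler_nat//.
  apply: le_trans (a_le n) _.
  by rewrite lerXn2r// ?nnegrE; lra.
- exact: cvg_cst.
- exact: cvg_series_cvg_0 is_cvg_series_natM_geometric.
Unshelve. all: by end_near. Qed.

End CentralBinomial.

(** * Quotients of the two binomials: geometric bound and limit *)

Lemma bin_ratio_le (m r : nat) :
  (2 <= m -> 'C(m + 1, r) * 8 ^ r <= 3 ^ r * 'C(4 * m, r))%N.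
Proof.
move=> m2; elim: r => [|r IH]; first by rewrite !bin0.
rewrite -(leq_pmul2l (ltn0Sn r)) !expnS.
have e1 := mul_bin_left (m + 1) r; have e2 := mul_bin_left (4 * m) r.
(* The quotient is a product of factors (m + 1 - r)/(4m - r); 3/8 is the value at m = 2, r = 0, the
   largest one. *)
have le : ((m + 1 - r) * 8 <= 3 * (4 * m - r))%N by lia.
have := leq_mul le IH.
suff -> : (r.+1 * ('C(m + 1, r.+1) * (8 * 8 ^ r)) =
   (m + 1 - r) * 8 * ('C(m + 1, r) * 8 ^ r))%N.
  suff -> : (r.+1 * (3 * 3 ^ r * 'C(4 * m, r.+1)) =
     3 * (4 * m - r) * (3 ^ r * 'C(4 * m, r)))%N by [].
  by rewrite mulnCA e2; ring.
by rewrite mulnA e1; ring.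
Qed.

Lemma cvg_bin_ratio (R : realType) (r : nat) :
  'C(m + 1, r)%:R / 'C(4 * m, r)%:R @[m --> \oo] --> (1 / 4 : R) ^+ r.
Proof.
elim: r => [|r IH].
  rewrite expr0; under eq_fun do rewrite !bin0 divr1.
  exact: cvg_cst.
have E m : 'C(m + 1, r.+1)%:R / 'C(4 * m, r.+1)%:R =
    (m + 1 - r)%:R / (4 * m - r)%:R *
    ('C(m + 1, r)%:R / 'C(4 * m, r)%:R) :> R.
  have n0 : r.+1%:R != 0 :> R by [].
  have binE n : 'C(n, r.+1)%:R = (n - r)%:R * 'C(n, r)%:R / r.+1%:R :> R.
    by apply: (mulIf n0); rewrite divfK// mulrC -!natrM mul_bin_left.
  by rewrite !binE -mulf_div divff ?invr_eq0// mulr1 mulf_div.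
under eq_fun do rewrite E.
rewrite exprS; apply: cvgM IH.
(* Past index [r], the truncated subtractions are genuine, and dividing by [n.+1] leaves a function
   of [harmonic n]. *)
rewrite -(cvg_shiftn r.+1).
have h0 := @cvg_harmonic R.
have -> : (fun n => (n + r.+1 + 1 - r)%:R / (4 * (n + r.+1) - r)%:R) =
    (fun n => (1 + harmonic n) / (4 + 3 * r%:R * harmonic n)) :> R^nat.
  apply/funext => n; rewrite /harmonic /=.
  have -> : (n + r.+1 + 1 - r = n.+1 + 1)%N by lia.
  have -> : (4 * (n + r.+1) - r = 4 * n.+1 + 3 * r)%N by lia.
  rewrite !natrD !natrM.
  have n0 : n.+1%:R != 0 :> R by [].
  have d0 : 4 * n.+1%:R + 3 * r%:R != 0 :> R.
    by rewrite -!natrM -natrD pnatr_eq0.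
  move: n.+1%:R n0 d0 => x n0 d0.
  by field; rewrite d0 n0.
rewrite (_ : 1 / 4 = (1 + 0) / (4 + 3 * r%:R * 0)); last by rewrite mulr0 !addr0.
apply: cvgM; first by apply: cvgD h0; exact: cvg_cst.
apply: cvgV; first by rewrite mulr0 addr0.
by apply: cvgD; [exact: cvg_cst|apply: cvgMl_tmp].
Qed.

(** * Tannery's theorem applied to [T] *)

Theorem theorem4p1 (R : realType) :
  T R m @[m --> \oo] --> (2 - Num.sqrt 2) / 2.
Proof.
pose F m r : R := ((r%:R - 1) * 'C(2 * r, r)%:R / 2 ^+ r) *
  ('C(m + 1, r)%:R / 'C(4 * m, r)%:R).
have e8 : 8 = 2 * 4 :> R by lra.
(* Starting the sum at 0 adds the terms -1 at [r = 0] and 0 at [r = 1]; the 1 compensates. *)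
have TE m : T R m = 1 + series (F m) m.+2.
  have F0 : F m 0 = -1 by rewrite /F !bin0 expr0 !divr1 sub0r !mulr1.
  have F1 : F m 1 = 0 by rewrite /F subrr !mul0r.
  rewrite /series /= big_ltn// big_ltn// F0 F1 add0r addrA subrr add0r.
  apply: eq_bigr => r _; rewrite /F invfM.
  by move: (_^-1) => y; move: (_^-1) => z; ring.
under eq_fun do rewrite TE.
rewrite (_ : _ / 2 = 1 + - Num.sqrt 2 / 2); last by field.
apply: cvgD; first exact: cvg_cst.
apply: (@tannery _ F (fun r => (r%:R - 1) * a R r)
  (fun r => r.+1%:R * (3 / 4) ^+ r) (fun m => m.+2)).
- move=> r.
  have -> : (r%:R - 1) * a R r =
      (r%:R - 1) * 'C(2 * r, r)%:R / 2 ^+ r * (1 / 4) ^+ r.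
    rewrite /a e8 exprMn expr_div_n expr1n.
    by rewrite invfM; ring.
  by apply: cvgMl_tmp; exact: cvg_bin_ratio.
- near=> m => r.
  have m2 : (2 <= m)%N by near: m; exact: nbhs_infty_ge.
  have ratio : 'C(m + 1, r)%:R / 'C(4 * m, r)%:R <= (3 / 8 : R) ^+ r.
    (* For [r > 4 * m] the denominator is 0, and so is the quotient, as [0^-1 = 0]. *)
    have [r4m|r4m] := leqP r (4 * m); last first.
      by rewrite (bin_small r4m) invr0 mulr0 exprn_ge0//; lra.
    rewrite ler_pdivrMr ?ltr0n ?bin_gt0// expr_div_n mulrAC.
    rewrite ler_pdivlMr ?exprn_gt0// -!natrX -!natrM ler_nat.
    exact: bin_ratio_le.
  (* With [a_le] and [ratio], the last factor is at most (1/2 * 4 * 3/8)^r = (3/4)^r; [r.+1] bounds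
     |r - 1| even at [r = 0]. *)
  have -> : F m r = (r%:R - 1) * (a R r * 4 ^+ r *
      ('C(m + 1, r)%:R / 'C(4 * m, r)%:R)).
    rewrite /F /a e8 exprMn.
    have u : (2 : R) ^+ r != 0 by rewrite expf_neq0.
    have v : (4 : R) ^+ r != 0 by rewrite expf_neq0.
    have -> : 'C(2 * r, r)%:R / (2 ^+ r * 4 ^+ r) * 4 ^+ r =
       'C(2 * r, r)%:R / 2 ^+ r :> R by field; rewrite u v.
    by rewrite !mulrA.
  have q0 : 0 <= 'C(m + 1, r)%:R / 'C(4 * m, r)%:R :> R by rewrite divr_ge0.
  have a4 : 0 <= a R r * 4 ^+ r by rewrite mulr_ge0 ?a_ge0 ?exprn_ge0.
  rewrite normrM (ger0_norm (mulr_ge0 a4 q0)) ler_pM ?mulr_ge0//.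
    by rewrite ler_norml -[r.+1%:R]natr1; have := ler0n R r; lra.
  have -> : (3 / 4 : R) ^+ r = (1 / 2) ^+ r * 4 ^+ r * (3 / 8) ^+ r.
    by rewrite -!exprMn; congr (_ ^+ _); lra.
  by rewrite ler_pM// ler_wpM2r ?exprn_ge0// a_le.
- exact: is_cvg_series_natM_geometric.
- by move=> A [n _ An]; exists n => // m /= nm; apply: An => /=; lia.
- exact: cvg_series_pred_a.
Unshelve. all: by end_near. Qed.
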